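(* Let $\mathcal{B}\in\mathcal{A}^q$ be a controllable non-empty system. Let $w=\begin{bmatrix}u\\ y\end{bmatrix}$ be an input-output partition of $\mathcal{B}$, and let $w_d=\begin{bmatrix}u_d\\ y_d\end{bmatrix}\in(\mathbb{R}^q)^{\mathbf{T}}$ be a trajectory of $\mathcal{B}$ of length $T$, i.e. $w_d\in\mathcal{B}|_{[1,T]}$. Let $L\in\mathbb{N}$ and assume that $u_d$ is persistently exciting of order $\mathbf{n}(\mathcal{B})+L$ for the model class $\mathcal{A}$. Then every trajectory $w\in\mathcal{B}|_{[1,L]}$ of length $L$ of $\mathcal{B}$ can be expressed as $$w=H_L(w_d)\,g$$ for some $g\in\mathbb{R}^{T-L+1}$ such that $\mathbb{1}^{\top}g=1$.
   Context: A system (behavior) is a subset $\mathcal{B}\subseteq(\mathbb{R}^q)^{\mathbb{Z}}$. The shift is $(\sigma w)(t)=w(t+1)$. $\mathcal{B}$ is affine if $v,w\in\mathcal{B}$, $\alpha\in\mathbb{R}$ imply $\alpha v+(1-\alpha)w\in\mathcal{B}$; time-invariant if $\sigma\mathcal{B}=\mathcal{B}$; complete if $w\in\mathcal{B}$ holds if and only if $w|_{[t_0,t_1]}\in\mathcal{B}|_{[t_0,t_1]}$ for all integers $t_0<t_1$, where $\mathcal{B}|_{[t_0,t_1]}$ is the set of restrictions of elements of $\mathcal{B}$ to $[t_0,t_1]$. $\mathcal{A}^q$ is the class of all complete affine time-invariant systems in $(\mathbb{R}^q)^{\mathbb{Z}}$ ($\mathcal{A}$ when $q$ is unspecified). $\mathbb{N}$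 is the set of positive integers and $\mathbf{T}=\{1,\dots,T\}$. $\mathcal{B}$ is controllable if for all $w_1,w_2\in\mathcal{B}$ and $t_1\in\mathbb{Z}$ there exist $t_2\ge t_1$ and $w\in\mathcal{B}$ with $w(t)=w_1(t)$ for $t<t_1$ and $w(t)=w_2(t)$ for $t\ge t_2$. For a partition $w=\begin{bmatrix}u\\ y\end{bmatrix}$ with $u(t)\in\mathbb{R}^m$, $y(t)\in\mathbb{R}^p$, $m+p=q$: $u$ is free for $\mathcal{B}$ if for every sequence $u\in(\mathbb{R}^m)^{\mathbb{Z}}$ there is $y$ with $\begin{bmatrix}u\\ y\end{bmatrix}\in\mathcal{B}$; it is maximally free if it is free and none of the components of $y$ can be chosen freely in addition (for no component $y_i$ of $y$ is $(u,y_i)$ free). If $u$ is maximally free, the partition is an input-output partition with input $u$ and output $y$. The order $\mathbf{n}(\mathcal{B})$ is the smallest $n$ for which $\mathcal{B}$ has an affine state-space representation, i.e. $\mathcal{B}=\{\begin{bmatrix}u\\ y\end{bmatrix}\mid \exists x\in(\mathbb{R}^n)^{\mathbb{Z}}: \sigma x=Ax+Bu+E,\ y=Cx+Du+F\}$ for some real matrices $A,B,C,D$ and vectors $E,F$ of compatible dimensions. For $v\in(\mathbb{R}^k)^{\mathbf{T}}$ and $L\in\mathbf{T}$, the Hankel matrix $H_L(v)\in\mathbb{R}^{kL\times(T-L+1)}$ has $j$-th column $\operatorname{col}(v(j),v(j+1),\dots,v(j+L-1))$, $j=1,\dots,T-L+1$. A finite sequence $w$ of length $L$ is identified with $\operatorname{col}(w(1),\dots,w(L))$.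 $\mathbb{1}$ is the all-ones column vector of appropriate size. A sequence $u\in(\mathbb{R}^m)^{\mathbf{T}}$ is persistently exciting of order $K\in\mathbf{T}$ for the model class $\mathcal{A}$ if $\operatorname{rank}\begin{bmatrix}H_K(u)\\ \mathbb{1}^{\top}\end{bmatrix}=mK+1$. *)

(* Defs.v *)
From mathcomp Require Import all_boot all_order all_algebra.
From mathcomp Require Import boolp classical_sets reals.

Set Implicit Arguments.
Unset Strict Implicit.
Unset Printing Implicit Defensive.

Import Order.TTheory GRing.Theory Num.Theory.
Local Open Scope classical_set_scope.
Local Open Scope ring_scope.

Section Systems.
Context {R : realType}.

Definition signal (q : nat) := int -> 'cV[R]_q.

Definition shift q (w : signal q) : signal q := fun t => w (t + 1).

(* A sequence indexed by {1, ..., L} is a function on 'I_L; the ordinal k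
   stands for the time k + 1. *)
Definition window q (t0 : int) (L : nat) (w : signal q) : 'I_L -> 'cV[R]_q :=
  fun k => w (t0 + k%:Z).
#[global] Arguments window {q} t0 L w.

(* [restriction B t0 L] is the restriction of B to [t0, t0 + L - 1]. *)
Definition restriction q (B : set (signal q)) (t0 : int) (L : nat) :
    set ('I_L -> 'cV[R]_q) :=
  window t0 L @` B.
#[global] Arguments restriction {q} B t0 L.

Definition affine_system q (B : set (signal q)) : Prop :=
  forall (v w : signal q) (a : R), B v -> B w ->
    B (fun t => a *: v t + (1 - a) *: w t).

Definition time_invariant q (B : set (signal q)) : Prop :=
  @shift q @` B = B.

Definition complete_system q (B : set (signal q)) : Prop :=
  forall w : signal q,
    B w <-> (forall t0 t1 : int, t0 < t1 ->
               restriction B t0 `|t1 - t0|.+1 (window t0 `|t1 - t0|.+1 w)).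

Definition model_class q (B : set (signal q)) : Prop :=
  [/\ complete_system B, affine_system B & time_invariant B].

Definition controllable q (B : set (signal q)) : Prop :=
  forall w1 w2 : signal q, B w1 -> B w2 -> forall t1 : int,
    exists (t2 : int) (w : signal q),
      [/\ t1 <= t2, B w,
          (forall t : int, t < t1 -> w t = w1 t) &
          (forall t : int, t2 <= t -> w t = w2 t)].

(* A partition w = [u; y] is, as usual, understood up to a reordering of the
   components of w: it is given by a bijection pi : 'I_m + 'I_p -> 'I_q (so that
   q = m + p). The stacked case w = col_mx u y, q = m + p, is
   pi = @unsplit m p. *)
Definition ucomp q m p (pi : 'I_m + 'I_p -> 'I_q) (v : 'cV[R]_q) : 'cV[R]_m :=
  \col_i v (pi (inl i)) 0.

Definition ycomp q m p (pi : 'I_m + 'I_p -> 'I_q) (v : 'cV[R]_q) : 'cV[R]_p :=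
  \col_i v (pi (inr i)) 0.

Definition free_input q m p (pi : 'I_m + 'I_p -> 'I_q) (B : set (signal q)) :
    Prop :=
  forall u : signal m, exists2 w, B w & forall t, ucomp pi (w t) = u t.

Definition free_with_output q m p (pi : 'I_m + 'I_p -> 'I_q)
    (B : set (signal q)) (i : 'I_p) : Prop :=
  forall (u : signal m) (yi : int -> R),
    exists2 w, B w & forall t, ucomp pi (w t) = u t /\ ycomp pi (w t) i 0 = yi t.

Definition maximally_free q m p (pi : 'I_m + 'I_p -> 'I_q)
    (B : set (signal q)) : Prop :=
  free_input pi B /\ forall i : 'I_p, ~ free_with_output pi B i.

Definition io_partition q m p (pi : 'I_m + 'I_p -> 'I_q)
    (B : set (signal q)) : Prop :=
  bijective pi /\ maximally_free pi B.

Definition state_space_system q m p n (pi : 'I_m + 'I_p -> 'I_q)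
    (A : 'M[R]_n) (B : 'M[R]_(n, m)) (C : 'M[R]_(p, n)) (D : 'M[R]_(p, m))
    (E : 'cV[R]_n) (F : 'cV[R]_p) : set (signal q) :=
  [set w | exists x : signal n, forall t : int,
     x (t + 1) = A *m x t + B *m ucomp pi (w t) + E /\
     ycomp pi (w t) = C *m x t + D *m ucomp pi (w t) + F].

(* The partition is existentially quantified, so that the order is an invariant
   of the system alone. *)
Definition has_state_space q (B : set (signal q)) (n : nat) : Prop :=
  exists (m p : nat) (pi : 'I_m + 'I_p -> 'I_q), bijective pi /\
  exists (A : 'M[R]_n) (B' : 'M[R]_(n, m)) (C : 'M[R]_(p, n)) (D : 'M[R]_(p, m))
         (E : 'cV[R]_n) (F : 'cV[R]_p),
    B = state_space_system pi A B' C D E F.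

Definition is_order q (B : set (signal q)) (n : nat) : Prop :=
  has_state_space B n /\ forall k, has_state_space B k -> (n <= k)%N.

(* [mxvec] is row-major, so this is col(v(1), ..., v(L)). *)
Definition colseq k L (v : 'I_L -> 'cV[R]_k) : 'cV[R]_(L * k) :=
  (mxvec (\matrix_(i < L, c < k) v i c 0))^T.

Definition seq_at k T (v : 'I_T -> 'cV[R]_k) (t : nat) : 'cV[R]_k :=
  odflt 0 (omap v (insub t)).

(* Only meaningful for L <= T; then every index j + i below is smaller than T
   and the default value of [seq_at] is never used. *)
Definition hankel k T (L : nat) (v : 'I_T -> 'cV[R]_k) :
    'M[R]_(L * k, (T - L).+1) :=
  \matrix_(r, j) colseq (fun i : 'I_L => seq_at v (j + i)) r 0.

Definition persistently_exciting m T (K : nat) (u : 'I_T -> 'cV[R]_m) : Prop :=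
  [/\ (1 <= K)%N, (K <= T)%N &
      \rank (col_mx (hankel K u) (const_mx 1 : 'rV[R]_(T - K).+1)) =
        (m * K + 1)%N].

End Systems.

(* Main.v *)
Require Import Defs.
From mathcomp Require Import all_boot all_order all_algebra.
From mathcomp Require Import boolp classical_sets reals.
From mathcomp Require Import zify ring.

(* If the conclusion fails, duality gives an affine functional on windows of
   length L, i.e. a difference operator w |-> (v(t))_t with a constant term, that
   vanishes on the data but not on all of B. A state-space representation of
   order n has at most as many inputs as the maximally free u, so on windows of
   length n + L the n + 1 shifts of this operator are linearly dependent modulo
   the affine functionals of u; by persistency of excitation the u-part of the
   relation is zero. Hence v satisfies one scalar linear recursion along all of
   B. Such sequences are determined by their past as well as by their future, so
   patching two trajectories by controllability shows that v is the same for all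
   trajectories; it vanishes on the data, so it vanishes on B. The given
   input-output partition need not be the one of the state-space representation;
   only the numbers of inputs are compared. *)

Set Implicit Arguments.
Unset Strict Implicit.
Unset Printing Implicit Defensive.

Import Order.TTheory GRing.Theory Num.Theory.
Local Open Scope classical_set_scope.
Local Open Scope ring_scope.

(** * Linear dependence of functions on a set, and scalar recursions *)

Lemma big_option (V : nmodType) (J : finType) (F : option J -> V) :
  \sum_o F o = \sum_j F (Some j) + F None.
Proof.
rewrite (bigD1 None) //= addrC (reindex_omap Some id) => [|[j|]] //=.
by congr (_ + _); apply: eq_bigl => j; rewrite eqxx.
Qed.

(** Equality is asked only on [A], so that the equations of a system may serve to express one
    functional through others. *)
Definition spanned (F : fieldType) (S : Type) (A : set S) (I : finType)
    (f : I -> S -> F) (g : S -> F) : Prop :=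
  exists a : I -> F, forall s, A s -> g s = \sum_i a i * f i s.

Lemma spanned_base (F : fieldType) (S : Type) (A : set S) (I : finType)
    (f : I -> S -> F) (i : I) : spanned A f (f i).
Proof.
exists (fun k => (k == i)%:R) => s _.
rewrite (bigD1 i) //= eqxx mul1r big1 ?addr0 // => k /negPf ->.
by rewrite mul0r.
Qed.

Lemma spanned_ext (F : fieldType) (S : Type) (A : set S) (I : finType)
    (f : I -> S -> F) (g h : S -> F) :
  (forall s, A s -> g s = h s) -> spanned A f h -> spanned A f g.
Proof. by move=> gh [a fa]; exists a => s As; rewrite gh ?fa. Qed.

Lemma spannedD (F : fieldType) (S : Type) (A : set S) (I : finType)
    (f : I -> S -> F) (g h : S -> F) :
  spanned A f g -> spanned A f h -> spanned A f (fun s => g s + h s).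
Proof.
move=> [a fa] [b fb]; exists (fun i => a i + b i) => s As.
by rewrite fa // fb // -big_split; apply: eq_bigr => i _; rewrite mulrDl.
Qed.

Lemma spannedZ (F : fieldType) (S : Type) (A : set S) (I : finType)
    (f : I -> S -> F) (c : F) (g : S -> F) :
  spanned A f g -> spanned A f (fun s => c * g s).
Proof.
move=> [a fa]; exists (fun i => c * a i) => s As.
by rewrite fa // mulr_sumr; apply: eq_bigr => i _; rewrite mulrA.
Qed.

Lemma spanned_sum (F : fieldType) (S : Type) (A : set S) (I J : finType)
    (P : pred J) (f : I -> S -> F) (g : J -> S -> F) :
  (forall j, P j -> spanned A f (g j)) ->
  spanned A f (fun s => \sum_(j | P j) g j s).
Proof.
move=> fg.
have /choice[a fa] j : exists b : I -> F, P j ->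
    forall s, A s -> g j s = \sum_i b i * f i s.
  by case: (boolP (P j)) => [/fg [b fb]|_]; [exists b | exists (fun=> 0)].
exists (fun i => \sum_(j | P j) a j i) => s As.
under [RHS]eq_bigr do rewrite mulr_suml.
by rewrite exchange_big; apply: eq_bigr => j Pj /=; rewrite fa.
Qed.

(** The coefficients of the [g j] form a matrix with more rows than columns, so its left kernel is
    nonzero. *)
Lemma spanned_dependent (F : fieldType) (S : Type) (A : set S) (I J : finType)
    (f : I -> S -> F) (g : J -> S -> F) :
  (forall j, spanned A f (g j)) -> (#|I| < #|J|)%N ->
  exists2 c : J -> F, exists j, c j != 0 &
    forall s, A s -> \sum_j c j * g j s = 0.
Proof.
move=> /choice[a fa] ltIJ.
pose M := \matrix_(j < #|J|, i < #|I|) a (enum_val j) (enum_val i).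
have /rowV0Pn[v /sub_kermxP vM v0] : kermx M != 0.
  rewrite kermx_eq0 /row_free; apply: contraTneq ltIJ => <-.
  by rewrite -leqNgt rank_leq_col.
exists (fun j => v 0 (enum_rank j)).
  have /rV0Pn[j vj] := v0.
  by exists (enum_val j); rewrite enum_valK.
move=> s As.
under eq_bigr do rewrite fa // mulr_sumr.
rewrite exchange_big big1 //= => i _.
under eq_bigr do rewrite mulrA.
rewrite -mulr_suml (reindex (enum_val : 'I_#|J| -> J)) /=; last first.
  by exists enum_rank => x _; rewrite (enum_valK, enum_rankK).
have /matrixP/(_ 0 (enum_rank i)) := vM.
rewrite !mxE => vMi; rewrite [X in X * _](_ : _ = 0) ?mul0r // -[RHS]vMi.
by apply: eq_bigr => j _; rewrite enum_valK mxE enum_rankK.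
Qed.

(* The largest nonzero coefficient makes the recursion explicit. *)
Lemma recursion_forward (F : fieldType) (n : nat) (a : 'I_n -> F)
    (e : int -> F) (t0 : int) :
  (exists i, a i != 0) ->
  (forall t : int, \sum_i a i * e (t + i%:Z) = 0) ->
  (forall t, t <= t0 -> e t = 0) -> forall t, e t = 0.
Proof.
move=> [i0 ai0] rec e0.
case: (arg_maxnP (P := fun i => a i != 0) (fun i : 'I_n => i : nat) ai0).
move=> k ak kmax.
have step t : (forall s, s < t -> e s = 0) -> e t = 0.
  move=> et; have := rec (t - k%:Z).
  rewrite (bigD1 k) //= subrK big1 ?addr0.
    by move/eqP; rewrite mulf_eq0 (negPf ak) => /eqP.
  move=> i ik; have [->|ai] := eqVneq (a i) 0; first by rewrite mul0r.
  rewrite et ?mulr0 //; have := kmax i ai.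
  have : (i : nat) != k by [].
  lia.
have all m : forall t, t <= t0 + m%:Z -> e t = 0.
  elim: m => [|m IH] t tm; first by apply: e0; lia.
  by apply: step => s st; apply: IH; lia.
by move=> t; apply: (all `|t - t0|%N); lia.
Qed.

Lemma recursion_backward (F : fieldType) (n : nat) (a : 'I_n -> F)
    (e : int -> F) (t0 : int) :
  (exists i, a i != 0) ->
  (forall t : int, \sum_i a i * e (t + i%:Z) = 0) ->
  (forall t, t0 <= t -> e t = 0) -> forall t, e t = 0.
Proof.
move=> [i0 ai0] rec e0 t; rewrite -[t]opprK.
apply: (@recursion_forward _ _ (fun i => a (rev_ord i)) (fun s => e (- s))
  (- t0)).
- by exists (rev_ord i0); rewrite rev_ordK.
- move=> s; have := rec (- s - n.-1%:Z).
  rewrite (reindex_inj rev_ord_inj) /= => sum0; rewrite -[RHS]sum0.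
  apply: eq_bigr => i _; congr (_ * e _).
  by have := ltn_ord i; lia.
- by move=> s st; apply: e0; lia.
Qed.

(** * Separation by duality and affine sets of signals *)

(** Take rows from [S] of the largest possible rank: a further row of [S] cannot raise it, hence
    lies in the row space. *)
Lemma span_matrix (F : fieldType) (N : nat) (S : set 'rV[F]_N) :
  exists k (M : 'M[F]_(k, N)), (forall i, S (row i M)) /\
    forall v, S v -> (v <= M)%MS.
Proof.
pose P r := `[< exists k (M : 'M[F]_(k, N)), (forall i, S (row i M)) /\
  \rank M = r >].
have P0 : exists r, P r.
  by exists 0%N; apply/asboolP; exists 0%N, 0; split; [case | rewrite mxrank0].
have Pub r : P r -> (r <= N)%N.
  by move=> /asboolP[k [M [_ <-]]]; exact: rank_leq_col.
case: (ex_maxnP P0 Pub) => r /asboolP[k [M [SM rM]]] rmax.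
exists k, M; split=> // v Sv.
have : (\rank (col_mx v M) <= r)%N.
  apply/rmax/asboolP; exists (1 + k)%N, (col_mx v M); split=> // i.
  rewrite -[i]splitK; case: (split i) => j /=.
    by rewrite rowKu row_id.
  by rewrite rowKd.
rewrite -rM => le_r; have sub : (M <= col_mx v M)%MS.
  by rewrite -addsmxE addsmxSr.
have /eqmxP eqM : (M == col_mx v M)%MS.
  by rewrite -(geq_leqif (mxrank_leqif_eq sub)).
by rewrite eqM -addsmxE addsmxSl.
Qed.

Lemma not_submx_separate (F : fieldType) (k N : nat) (M : 'M[F]_(k, N))
    (v : 'rV[F]_N) :
  ~~ (v <= M)%MS -> exists2 z : 'cV[F]_N, M *m z = 0 & v *m z != 0.
Proof.
rewrite submxE => /rV0Pn[j vj]; exists (col j (cokermx M)).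
  by rewrite colE mulmxA mulmx_coker mul0mx.
by apply/rV0Pn; exists 0; rewrite colE mulmxA -colE mxE.
Qed.

Lemma affine_sum (R : realType) (q : nat) (B : set (@signal R q)) (I : Type)
    (r : seq I) (a : I -> R) (v0 : signal q) (v : I -> signal q) :
  affine_system B -> B v0 -> (forall i, B (v i)) ->
  B (fun t => v0 t + \sum_(i <- r) a i *: (v i t - v0 t)).
Proof.
move=> affB Bv0 Bv.
(* Two-point combinations suffice: form [c u + (1 - c) v0], take its midpoint with [w], then twice
   the midpoint minus [v0]. *)
have step w u (c : R) : B w -> B u -> B (fun t => w t + c *: (u t - v0 t)).
  move=> Bw Bu.
  have B1 := affB u v0 c Bu Bv0.
  have B2 := affB w _ 2^-1 Bw B1.
  have := affB _ v0 2 B2 Bv0; congr B; apply/funext => t.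
  by apply/matrixP => i j; rewrite !mxE; field.
elim: r => [|i r IH].
  rewrite (_ : (fun _ => _) = v0) //.
  by apply/funext => t; rewrite big_nil addr0.
have := step _ _ (a i) IH (Bv i); congr B; apply/funext => t.
by rewrite big_cons addrAC addrA.
Qed.

(** An appended coordinate 1 turns affine combinations into linear ones. Either the row of [b] lies
    in the span of the sampled trajectories, or a functional separating it is an affine relation on
    [B]. *)
Lemma affine_interpolation (R : realType) (q : nat) (B : set (@signal R q))
    (J : finType) (pos : J -> int * 'I_q) (b : J -> R) :
  affine_system B -> B !=set0 ->
  (exists2 w, B w & forall j, w (pos j).1 (pos j).2 0 = b j) \/
  (exists (c : J -> R) (c0 : R), (exists j, c j != 0) /\
     forall w, B w -> \sum_j c j * w (pos j).1 (pos j).2 0 + c0 = 0).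
Proof.
move=> affB [v0 Bv0].
pose r (f : J -> R) : 'rV[R]_#|{: option J}| :=
  \row_k oapp f 1 (enum_val k).
pose x (w : signal q) j : R := w (pos j).1 (pos j).2 0.
have rE f (z : 'cV_#|{: option J}|) : (r f *m z) 0 0 =
    \sum_j z (enum_rank (Some j)) 0 * f j + z (enum_rank None) 0.
  rewrite mxE (reindex (enum_rank : option J -> _)) /=; last first.
    by exists enum_val => y _; rewrite (enum_valK, enum_rankK).
  rewrite big_option !mxE enum_rankK mul1r; congr (_ + _).
  by apply: eq_bigr => j _; rewrite mxE enum_rankK mulrC.
have [k [M [SM subM]]] := span_matrix [set r (x w) | w in B].
have [/submxP[D rD]|/not_submx_separate[z Mz rz]] := boolP (r b <= M)%MS.
  left.
  have /choice[v vP] i : exists w, B w /\ r (x w) = row i M.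
    by have [w] := SM i; exists w.
  have Dsum : \sum_i D 0 i = 1.
    have /matrixP/(_ 0 (enum_rank None)) := rD.
    rewrite !mxE enum_rankK /= => ->; apply: eq_bigr => i _.
    have [_ /matrixP/(_ 0 (enum_rank None))] := vP i.
    by rewrite !mxE enum_rankK /= => <-; rewrite mulr1.
  exists (fun t => v0 t + \sum_i D 0 i *: (v i t - v0 t)).
    by apply: affine_sum => // i; case: (vP i).
  move=> j; have /matrixP/(_ 0 (enum_rank (Some j))) := rD.
  rewrite !mxE enum_rankK /= => ->; rewrite summxE.
  under [X in _ + X]eq_bigr do rewrite !mxE mulrBr.
  rewrite sumrB -mulr_suml Dsum mul1r addrC subrK; apply: eq_bigr => i _.
  have [_ /matrixP/(_ 0 (enum_rank (Some j)))] := vP i.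
  by rewrite !mxE enum_rankK /= => <-.
right; exists (fun j => z (enum_rank (Some j)) 0), (z (enum_rank None) 0).
have rel w : B w ->
    \sum_j z (enum_rank (Some j)) 0 * x w j + z (enum_rank None) 0 = 0.
  move=> Bw; rewrite -rE.
  have /submxP[D ->] : (r (x w) <= M)%MS by apply: subM; exists w.
  by rewrite -mulmxA Mz mulmx0 mxE.
(* If all [c j] vanished, evaluation at [v0] would kill the constant too, and nothing would separate
   [b]. *)
split=> //; apply: contrapT => /forallNP z0.
have {}z0 j : z (enum_rank (Some j)) 0 = 0 by apply/eqP/negPn/negP; exact: z0.
have z1 : z (enum_rank None) 0 = 0.
  by have := rel _ Bv0; rewrite big1 ?add0r // => j _; rewrite z0 mul0r.
case/negP: rz; apply/eqP/matrixP => i j.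
rewrite !ord1 rE z1 big1 ?mxE ?addr0 //.
by move=> l _; rewrite z0 mul0r.
Qed.

(* Coordinates are fixed one at a time: on a decreasing sequence of nonempty
   affine sets a single coordinate either takes every value on all of them or is
   eventually constant. *)
Lemma affine_tower (R : realType) (q : nat) (Q : nat -> set (@signal R q)) :
  (forall N, affine_system (Q N)) -> (forall N, Q N !=set0) ->
  (forall N, Q N.+1 `<=` Q N) ->
  exists w : signal q, forall N (t0 : int) K,
    exists2 v, Q N v & window t0 K v = window t0 K w.
Proof.
pose good (P : nat -> set (@signal R q)) := [/\ forall N, affine_system (P N),
  forall N, P N !=set0 & forall N, P N.+1 `<=` P N].
pose fix1 (P : nat -> set (@signal R q)) (x : int * 'I_q) a N :=
  P N `&` [set v : signal q | v x.1 x.2 0 = a].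
have ext P x : good P -> exists a, forall N, fix1 P x a N !=set0.
  move=> [aff ne dec].
  have {}dec M N : (M <= N)%N -> P N `<=` P M.
    elim: N => [|N IH]; first by rewrite leqn0 => /eqP ->.
    rewrite leq_eqVlt => /orP[/eqP -> //|MN].
    exact: subset_trans (dec N) (IH MN).
  have [[N0 cst]|/forallNP var] := pselect (exists N0, forall v w,
      P N0 v -> P N0 w -> v x.1 x.2 0 = w x.1 x.2 0).
    have [v0 Pv0] := ne N0; exists (v0 x.1 x.2 0) => N.
    have [v Pv] := ne (maxn N0 N).
    exists v; split; first exact: dec (leq_maxr _ _) _ Pv.
    by apply: cst => //; apply: dec (leq_maxl _ _) _ Pv.
  exists 0 => N; have := var N.
  move=> /existsNP[v /existsNP[w /not_implyP[Pv /not_implyP[Pw /eqP vw]]]].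
  (* This weight gives the coordinate [x] of the combination the value 0. *)
  pose c := - w x.1 x.2 0 / (v x.1 x.2 0 - w x.1 x.2 0).
  exists (fun t => c *: v t + (1 - c) *: w t); split; first exact: aff.
  by rewrite /= !mxE /c; field; rewrite subr_eq0.
have good1 P x a : good P -> (forall N, fix1 P x a N !=set0) ->
    good (fix1 P x a).
  move=> [aff ne dec] ne1; split=> // [N v w c [Pv va] [Pw wa]|N v [Pv va]].
    split; first exact: aff.
    by rewrite /= !mxE va wa; ring.
  by split=> //; apply: dec.
move=> affQ neQ decQ.
pose pick P x := xget 0 [set a | forall N, fix1 P x a N !=set0].
(* Coordinates are fixed in the order of their codes; a number that codes none changes nothing. *)
pose step k P := if unpickle k is Some x then fix1 P x (pick P x) else P.
pose tower := fix tower k := if k is k'.+1 then step k' (tower k') else Q.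
have tower_good k : good (tower k).
  elim: k => [|k IH] //=; rewrite /step; case: unpickle => [x|] //.
  by apply: good1 => // N; have := xgetPex 0 (ext _ x IH); apply.
have tower_sub k l N : (k <= l)%N -> tower l N `<=` tower k N.
  elim: l => [|l IH]; first by rewrite leqn0 => /eqP ->.
  rewrite leq_eqVlt => /orP[/eqP -> //|kl]; apply: subset_trans (IH kl).
  by rewrite /= /step; case: unpickle => [x|] // v [].
exists (fun t => \col_j pick (tower (pickle (t, j))) (t, j)) => N t0 K.
pose k := (\max_(i < K) \max_(j < q) (pickle ((t0 + i%:Z)%R, j)).+1)%N.
have [_ /(_ N)[v tv] _] := tower_good k.
exists v; first exact: tower_sub (leq0n k) _ tv.
apply/funext => i; apply/colP => j; rewrite /window mxE.
set x := (t0 + i%:Z, j).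
have lt_xk : (pickle x < k)%N.
  by apply: leq_trans (leq_bigmax i); apply: leq_trans (leq_bigmax j).
have /= := tower_sub _ _ N lt_xk _ tv.
by rewrite /step pickleK => -[].
Qed.

(** * Freeness versus affine difference equations *)

Lemma time_invariant_shift (R : realType) (q : nat) (B : set (@signal R q))
    (w : signal q) (s : int) :
  time_invariant B -> B w -> B (fun t => w (t + s)).
Proof.
move=> tiB Bw.
have fwd v : B v -> B (fun t => v (t + 1)).
  by move=> Bv; rewrite -tiB; exists v.
have bwd v : B v -> B (fun t => v (t - 1)).
  rewrite -{1}tiB => -[u Bu <-]; congr B: Bu; apply/funext => t.
  by rewrite /shift subrK.
elim/int_rec: s => [|s IH|s IH].
- by congr B: Bw; apply/funext => t; rewrite addr0.
- by have := fwd _ IH; congr B; apply/funext => t; congr w; lia.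
- by have := bwd _ IH; congr B; apply/funext => t; congr w; lia.
Qed.

(* By completeness, components that are not free already fail to be free on a
   bounded window, where duality yields an affine difference equation. *)
Lemma free_or_relation (R : realType) (q : nat) (B : set (@signal R q))
    (D : finType) (h : D -> 'I_q) :
  model_class B -> B !=set0 ->
  (forall s : D -> int -> R,
     exists2 w, B w & forall t d, w t (h d) 0 = s d t) \/
  (exists M (c : 'I_M * D -> R) (c0 : R), (exists j, c j != 0) /\
     forall w t, B w ->
       \sum_j c j * w (t + j.1%:Z) (h j.2) 0 + c0 = 0).
Proof.
move=> [compB affB tiB] neB.
set rel := (X in _ \/ X).
have [|norel] := pselect rel; [by right | left => s].
(* [Q N] prescribes [s] only on [[-N, N]], a finite interpolation problem; a relation obstructing it
   would, after a time shift, contradict [norel]. *)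
pose Q (N : nat) : set (signal q) := B `&`
  [set w : signal q | forall t d, (`|t| <= N)%N -> w t (h d) 0 = s d t].
have [N v w a [Bv vs] [Bw ws]|N|N w [Bw ws]|w Qw] := @affine_tower R q Q.
- split=> [|t d tN]; first exact: affB.
  by rewrite !mxE vs // ws //; ring.
- have [[w Bw ws]|] := @affine_interpolation R q B ('I_N.*2.+1 * D)%type
    (fun j => (- N%:Z + j.1%:Z, h j.2)) (fun j => s j.2 (- N%:Z + j.1%:Z))
    affB neB.
    exists w; split=> // t d tN.
    have ltk : (`|(t + N%:Z)%R| < N.*2.+1)%N by lia.
    have := ws (Ordinal ltk, d) => /=.
    by have -> : - N%:Z + `|(t + N%:Z)%R|%N = t by lia.
  move=> [c [c0 [cn0 crel]]]; case: norel; exists N.*2.+1, c, c0; split=> //.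
  move=> w t Bw.
  have wrel := crel _ (time_invariant_shift (t + N%:Z) tiB Bw).
  rewrite -[RHS]wrel; congr (_ + _); apply: eq_bigr => j _ /=.
  by congr (_ * w _ _ _); ring.
- by split=> // t d tN; apply: ws; apply: leqW.
exists w.
  apply/compB => t0 t1 _.
  by have [v [Bv _] vw] := Qw 0%N t0 `|t1 - t0|.+1; exists v.
move=> t d; have [v [_ vs] vw] := Qw `|t|%N t 1%N.
rewrite -vs //; have := congr1 (fun f => f ord0) vw.
by rewrite /window addr0 => ->.
Qed.

(** * Comparison of the numbers of inputs *)

(** The trajectory [w0] supplies the past, as the state equation need not be solvable backwards;
    from time 1 on, [u] drives the state forward from [x0 1]. *)
Lemma state_space_forced (R : realType) (q m p n : nat)
    (pi : 'I_m + 'I_p -> 'I_q) (A : 'M[R]_n) (B : 'M[R]_(n, m))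
    (C : 'M[R]_(p, n)) (D : 'M[R]_(p, m)) (E : 'cV[R]_n) (F : 'cV[R]_p)
    (w0 : signal q) (u : int -> 'cV[R]_m) :
  bijective pi -> state_space_system pi A B C D E F w0 ->
  exists2 w, state_space_system pi A B C D E F w &
    forall t : int, 1 <= t -> ucomp pi (w t) = u t.
Proof.
move=> [g piK gK] [x0 x0P].
pose v (t : int) := if 1 <= t then u t else ucomp pi (w0 t).
pose X := fix X k := if k is k'.+1 then
  A *m X k' + B *m u (1 + k'%:Z) + E else x0 1.
pose x (t : int) := if 1 <= t then X `|t - 1|%N else x0 t.
pose y (t : int) := C *m x t + D *m v t + F.
pose w (t : int) : 'cV[R]_q := \col_j
  match g j with inl c => v t c 0 | inr c => y t c 0 end.
have wu t : ucomp pi (w t) = v t by apply/colP => c; rewrite !mxE piK.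
have wy t : ycomp pi (w t) = y t by apply/colP => c; rewrite mxE mxE piK.
exists w => [|t t1]; last by rewrite wu /v t1.
exists x => t; rewrite wu wy; split=> //.
have [t1|t1] := leP 1 t.
  rewrite /x /v t1 (_ : 1 <= t + 1); last by lia.
  have -> : `|(t + 1 - 1)%R|%N = `|(t - 1)%R|%N.+1 by lia.
  by rewrite /= (_ : 1 + `|(t - 1)%R|%N%:Z = t :> int) //; lia.
rewrite /v /x [1 <= t]leNgt t1 /= -(x0P t).1.
have [->|t0] := eqVneq t 0; first by rewrite add0r.
by rewrite (_ : (1 <= t + 1) = false) //; lia.
Qed.

Lemma affine_form_eq0 (F : fieldType) (J : finType) (c : J -> F) (c0 : F) :
  (forall b : J -> F, \sum_j c j * b j + c0 = 0) -> forall j, c j = 0.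
Proof.
move=> rel j; have := rel (fun k => (k == j)%:R).
have := rel (fun=> 0); rewrite big1 ?add0r => [->|k _]; last by rewrite mulr0.
rewrite (bigD1 j) //= eqxx mulr1 big1 ?addr0 // => k /negPf ->.
by rewrite mulr0.
Qed.

(** Since [u] together with the output [i] is not free, a difference equation holds; freeness of [u]
    forces that output to occur in it. The index [e] marks its latest occurrence. *)
Lemma output_recursion (R : realType) (q m p : nat) (B : set (@signal R q))
    (pi : 'I_m + 'I_p -> 'I_q) (i : 'I_p) :
  model_class B -> B !=set0 -> free_input pi B -> ~ free_with_output pi B i ->
  exists M (a : 'I_M -> 'I_m -> R) (b : 'I_M -> R) (c0 : R) (e : 'I_M),
    [/\ b e != 0, forall k : 'I_M, (e < k)%N -> b k = 0 &
      forall w t, B w ->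
        \sum_k \sum_c a k c * w (t + k%:Z) (pi (inl c)) 0 +
        \sum_k b k * w (t + k%:Z) (pi (inr i)) 0 + c0 = 0].
Proof.
move=> modB neB freeu nfree.
have [frh|] := @free_or_relation R q B (option 'I_m)
    (oapp (fun c => pi (inl c)) (pi (inr i))) modB neB.
  case: nfree => u yi.
  have [w Bw ws] := frh (fun o t => oapp (fun c => u t c 0) (yi t) o).
  exists w => // t; split; last by rewrite mxE (ws t None).
  by apply/colP => c; rewrite mxE (ws t (Some c)).
move=> [M [c [c0 [cn0 crel]]]].
pose a k l := c (k, Some l).
pose b k := c (k, None).
have rel w t : B w -> \sum_k \sum_l a k l * w (t + k%:Z) (pi (inl l)) 0 +
    \sum_k b k * w (t + k%:Z) (pi (inr i)) 0 + c0 = 0.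
  move=> Bw; rewrite -[RHS](crel w t Bw); congr (_ + _).
  transitivity (\sum_k \sum_o c (k, o) *
      w (t + k%:Z) (oapp (fun l => pi (inl l)) (pi (inr i)) o) 0).
    by rewrite -big_split; apply: eq_bigr => k _; rewrite big_option.
  by rewrite pair_bigA; apply: eq_bigr => -[k o] _.
have [e0 be0] : exists e, b e != 0.
  apply: contrapT => /forallNP b0.
  have {}b0 k : b k = 0 by apply/eqP/negPn/negP; exact: b0.
  have a0 : forall kc : 'I_M * 'I_m, a kc.1 kc.2 = 0.
    apply: (@affine_form_eq0 _ _ _ c0) => s.
    pose u (t : int) : 'cV[R]_m :=
      \col_l oapp (fun k : 'I_M => s (k, l)) 0 (insub `|t|%N).
    have [w Bw wu] := freeu u.
    rewrite -[RHS](rel w 0 Bw); congr (_ + _).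
    rewrite [X in _ = _ + X]big1 ?addr0 => [|k _]; last by rewrite b0 mul0r.
    rewrite [RHS]pair_bigA; apply: eq_bigr => -[k l] _ /=; congr (_ * _).
    have /colP/(_ l) := wu (0 + k%:Z); rewrite !mxE => ->.
    by rewrite add0r absz_nat valK.
  case: cn0 => -[k [l|]]; first by rewrite -/(a k l) (a0 (k, l)) eqxx.
  by rewrite -/(b k) b0 eqxx.
case: (arg_maxnP (P := fun k => b k != 0) (fun k : 'I_M => k : nat) be0).
move=> e be emax; exists M, a, b, c0, e; split=> // k ek.
apply/eqP/negPn/negP => /emax /(leq_trans ek).
by rewrite ltnn.
Qed.

(** On a window of length [K] the output recursions express all entries through [(K + M) m] inputs,
    [p M] initial outputs and 1, whereas the [K m'] inputs of the state-space form take arbitrary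
    values. For large [K] this excludes [m' > m]. *)
Lemma inputs_leq (R : realType) (q m p m' p' n : nat) (B : set (@signal R q))
    (pi : 'I_m + 'I_p -> 'I_q) (pi' : 'I_m' + 'I_p' -> 'I_q)
    (A : 'M[R]_n) (B' : 'M[R]_(n, m')) (C : 'M[R]_(p', n)) (D : 'M[R]_(p', m'))
    (E : 'cV[R]_n) (F : 'cV[R]_p') :
  model_class B -> B !=set0 -> io_partition pi B -> bijective pi' ->
  B = state_space_system pi' A B' C D E F -> (m' <= m)%N.
Proof.
move=> modB neB [[g piK gK] [freeu nfree]] bij' ssB.
rewrite leqNgt; apply/negP => ltm.
have /choice[M_ recM] i := output_recursion modB neB freeu (nfree i).
pose M := (\max_i M_ i)%N.
(* The least [K] for which [m' = m + 1] gives [K m' > (K + M) m + p M]. *)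
pose K := (M * m + p * M).+1.
(* The recursions need not be causal: an output may involve later inputs, hence the longer input
   window. *)
pose f (j : option ('I_(K + M) * 'I_m + 'I_p * 'I_M)) (w : signal q) : R :=
  match j with
  | Some (inl kc) => w (1 + kc.1%:Z) (pi (inl kc.2)) 0
  | Some (inr ik) => w (1 + ik.2%:Z) (pi (inr ik.1)) 0
  | None => 1
  end.
have span1 a : spanned B f (fun=> a).
  apply: spanned_ext (spannedZ a (spanned_base B f None)) => w _ /=.
  by rewrite mulr1.
have spanu k c : (k < K + M)%N ->
    spanned B f (fun w => w (1 + k%:Z) (pi (inl c)) 0).
  by move=> lt_k; exact: (spanned_base B f (Some (inl (Ordinal lt_k, c)))).
have spany i k : (k < K)%N ->
    spanned B f (fun w => w (1 + k%:Z) (pi (inr i)) 0).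
  have [a [b [c0 [e [be bk rel]]]]] := recM i.
  elim/ltn_ind: k => k IH lt_k.
  have [lt_kM|le_Mk] := ltnP k M.
    exact: (spanned_base B f (Some (inr (i, Ordinal lt_kM)))).
  have le_MiM : (M_ i <= M)%N by exact: leq_bigmax.
  have lt_e := ltn_ord e.
  (* This start puts the leading output term at time [1 + k]; the truncated subtraction is exact
     because [k >= M > e]. *)
  pose t : int := 1 + (k - e)%N%:Z.
  apply: (@spanned_ext _ _ _ _ _ _ (fun w : signal q => - (b e)^-1 *
    (\sum_j \sum_c a j c * w (t + j%:Z) (pi (inl c)) 0 +
     \sum_(j | j != e) b j * w (t + j%:Z) (pi (inr i)) 0 + c0))).
    move=> w /(rel w t); set s1 := \sum_k _; rewrite (bigD1 e) //=.
    have -> : t + e%:Z = 1 + k%:Z by rewrite /t; lia.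
    set x := w _ _ _; set s2 := \sum_(j | _) _.
    move=> eq0; have -> : s1 + s2 + c0 = - (b e * x).
      by apply/eqP; rewrite -subr_eq0 opprK -[X in _ == X]eq0; apply/eqP; ring.
    by field.
  apply/spannedZ/spannedD => //; apply: spannedD.
    apply: spanned_sum => j _; apply: spanned_sum => c _; apply: spannedZ.
    have := ltn_ord j => lt_j.
    by rewrite /t -addrA -PoszD; apply: spanu; lia.
  apply: spanned_sum => j ne_j.
  have [lt_ej|le_je] := ltnP e j.
    by rewrite bk //; apply: spanned_ext (span1 0) => w _; rewrite mul0r.
  have lt_je : (j < e)%N by rewrite ltn_neqAle le_je andbT.
  by apply: spannedZ; rewrite /t -addrA -PoszD; apply: IH; lia.
have spanw k l : (k < K)%N -> spanned B f (fun w => w (1 + k%:Z) l 0).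
  move=> lt_k; rewrite -[l]gK; case: (g l) => c; last exact: spany.
  by apply: spanu; apply: leq_trans lt_k (leq_addr _ _).
pose h (j : option ('I_K * 'I_m')) (w : signal q) : R :=
  oapp (fun kc : 'I_K * 'I_m' => w (1 + kc.1%:Z) (pi' (inl kc.2)) 0) 1 j.
have spanh j : spanned B f (h j).
  by case: j => [[k c]|]; [exact: spanw | exact: span1].
have [|c [j cj] rel] := spanned_dependent spanh.
  rewrite !card_option card_sum !card_prod !card_ord ltnS.
  by rewrite /K; nia.
have {}rel w : B w -> \sum_kc c (Some kc) * w (1 + kc.1%:Z) (pi' (inl kc.2)) 0 +
    c None = 0.
  by move=> /rel; rewrite big_option mulr1.
(* The inputs are arbitrary from time 1 on, so their coefficients vanish; the constant then vanishes
   because [B] is nonempty. *)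
have c0 : forall kc, c (Some kc) = 0.
  apply: (@affine_form_eq0 _ _ _ (c None)) => s.
  pose u (t : int) : 'cV[R]_m' :=
    \col_l oapp (fun k : 'I_K => s (k, l)) 0 (insub `|(t - 1)%R|%N).
  have [w0 Bw0] := neB; move: (Bw0); rewrite ssB => ssw0.
  have [w] := state_space_forced u bij' ssw0; rewrite -ssB => Bw wu.
  rewrite -[RHS](rel w Bw); congr (_ + _); apply: eq_bigr => -[k l] _ /=.
  have ge1 : 1 <= 1 + k%:Z by lia.
  have /colP/(_ l) := wu _ ge1; rewrite !mxE => ->.
  by rewrite addrAC subrr add0r absz_nat valK.
case: j cj => [kc|]; first by rewrite c0 eqxx.
have [w Bw] := neB; have := rel w Bw.
by rewrite big1 ?add0r => [->|kc _]; rewrite ?eqxx ?c0 ?mul0r.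
Qed.

(** * Hankel matrices and persistency of excitation *)

Lemma sum_mxvec_index (V : nmodType) (m n : nat) (F : 'I_(m * n) -> V) :
  \sum_r F r = \sum_i \sum_j F (mxvec_index i j).
Proof.
rewrite pair_bigA (reindex _ (curry_mxvec_bij m n)) /=.
by apply: eq_bigr => -[].
Qed.

Lemma hankel_window (R : realType) (k T L : nat) (w : @signal R k)
    (i : 'I_L) (c : 'I_k) (j : 'I_(T - L).+1) :
  (L <= T)%N ->
  hankel L (window 1 T w) (mxvec_index i c) j = w (1 + j%:Z + i%:Z) c 0.
Proof.
move=> le_LT; rewrite !mxE mxvecE mxE /seq_at.
have lt_T : (j + i < T)%N by have := ltn_ord i; have := ltn_ord j; lia.
by rewrite insubT /= /window PoszD addrA.
Qed.

(** The coefficients form a row vector in the left kernel of the Hankel matrix with its row of ones,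
    which has full row rank. *)
Lemma exciting_form_eq0 (R : realType) (m T K : nat) (u : @signal R m)
    (b : 'I_K -> 'I_m -> R) (c : R) :
  persistently_exciting K (window 1 T u) ->
  (forall j : nat, (j <= T - K)%N ->
     \sum_k \sum_l b k l * u (1 + j%:Z + k%:Z) l 0 + c = 0) ->
  (forall k l, b k l = 0) /\ c = 0.
Proof.
move=> [K1 KT rkH] rel.
pose v := row_mx (mxvec (\matrix_(k, l) b k l)) (c%:M : 'M_1).
have free : row_free (col_mx (hankel K (window 1 T u))
    (const_mx 1 : 'rV[R]_(T - K).+1)).
  by rewrite /row_free rkH mulnC.
have v0 : v = 0.
  apply: (row_free_inj free); rewrite mul0mx mul_row_col.
  apply/rowP => j; rewrite mxE [X in _ + X]mxE big_ord1 !mxE mulr1 /=.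
  rewrite -[RHS](rel j); last by rewrite -ltnS.
  rewrite sum_mxvec_index mulr1n; congr (_ + _); apply: eq_bigr => k _.
  by apply: eq_bigr => l _; rewrite mxvecE mxE hankel_window.
have vlr : mxvec (\matrix_(k, l) b k l) = 0 /\ (c%:M : 'M_1) = 0.
  by apply: eq_row_mx; rewrite row_mx0.
split=> [k l|].
  have /rowP/(_ (mxvec_index k l)) := vlr.1.
  by rewrite mxvecE !mxE.
by have /matrixP/(_ 0 0) := vlr.2; rewrite !mxE.
Qed.

(** * Difference forms along trajectories *)

Definition difference_form (R : realType) (q L : nat) (a : 'I_L -> 'I_q -> R)
    (c : R) (w : @signal R q) (t : int) : R :=
  \sum_k \sum_l a k l * w (t + k%:Z) l 0 + c.

(** Iterating the state equation leaves only the state at time 1, the inputs and 1. Functionals act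
    on pairs of trajectory and state because [w] need not determine [x]. *)
Lemma state_space_window_spanned (R : realType) (q m p n : nat)
    (pi : 'I_m + 'I_p -> 'I_q) (A : 'M[R]_n) (B : 'M[R]_(n, m))
    (C : 'M[R]_(p, n)) (D : 'M[R]_(p, m)) (E : 'cV[R]_n) (F : 'cV[R]_p)
    (K : nat) :
  bijective pi ->
  exists f : option ('I_n + 'I_K * 'I_m) -> signal q * signal n -> R,
    (forall s, f None s = 1) /\
    forall k l, (k < K)%N ->
      spanned [set s : signal q * signal n | forall t : int,
          s.2 (t + 1) = A *m s.2 t + B *m ucomp pi (s.1 t) + E /\
          ycomp pi (s.1 t) = C *m s.2 t + D *m ucomp pi (s.1 t) + F]
        f (fun s => s.1 (1 + k%:Z) l 0).
Proof.
move=> [g piK gK].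
pose f (j : option ('I_n + 'I_K * 'I_m)) (s : signal q * signal n) : R :=
  match j with
  | Some (inl i) => s.2 1 i 0
  | Some (inr kc) => s.1 (1 + kc.1%:Z) (pi (inl kc.2)) 0
  | None => 1
  end.
exists f; split=> //; set S := mkset _.
have span1 a : spanned S f (fun=> a).
  apply: spanned_ext (spannedZ a (spanned_base S f None)) => w _ /=.
  by rewrite mulr1.
have spanu k c : (k < K)%N ->
    spanned S f (fun s => ucomp pi (s.1 (1 + k%:Z)) c 0).
  move=> lt_k.
  apply: spanned_ext (spanned_base S f (Some (inr (Ordinal lt_k, c)))).
  by move=> s _; rewrite mxE.
have spanM r1 r2 (M : 'M[R]_(r1, r2)) (z : signal q * signal n -> 'cV[R]_r2) i :
    (forall j, spanned S f (fun s => z s j 0)) ->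
    spanned S f (fun s => (M *m z s) i 0).
  move=> spanz.
  apply: (@spanned_ext _ _ _ _ _ _ (fun s => \sum_j M i j * z s j 0)).
    by move=> s _; rewrite mxE.
  by apply: spanned_sum => j _; apply: spannedZ.
have spanx k i : (k < K)%N -> spanned S f (fun s => s.2 (1 + k%:Z) i 0).
  elim: k i => [|k IH] i lt_k.
    apply: spanned_ext (spanned_base S f (Some (inl i))) => s _ /=.
    by rewrite addr0.
  have lt_k' := ltnW lt_k.
  apply: (@spanned_ext _ _ _ _ _ _ (fun s => (A *m s.2 (1 + k%:Z)) i 0 +
      (B *m ucomp pi (s.1 (1 + k%:Z))) i 0 + E i 0)).
    have -> : 1 + k.+1%:Z = 1 + k%:Z + 1 by lia.
    move=> s /(_ (1 + k%:Z))[-> _].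
    by rewrite !mxE.
  apply: spannedD => //; apply: spannedD; apply: spanM => j; last exact: spanu.
  exact: IH.
move=> k l lt_k; rewrite -[l]gK; case: (g l) => c.
  by apply: spanned_ext (spanu k c lt_k) => s _; rewrite mxE.
apply: (@spanned_ext _ _ _ _ _ _ (fun s => (C *m s.2 (1 + k%:Z)) c 0 +
    (D *m ucomp pi (s.1 (1 + k%:Z))) c 0 + F c 0)).
  move=> s /(_ (1 + k%:Z))[_ /colP/(_ c)]; rewrite mxE => ->.
  by rewrite !mxE.
apply: spannedD => //; apply: spannedD; apply: spanM => j; last exact: spanu.
exact: spanx.
Qed.

(* On windows of length n + L the n + 1 shifts of the form, the input entries
   and the constant 1 are (n + 1) + m (n + L) + 1 functionals on a space of
   dimension at most n + m (n + L) + 1. Persistency of excitation removes the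
   input part of a linear relation between them. *)
Lemma difference_form_recursion (R : realType) (q m p n T L : nat)
    (B : set (@signal R q)) (pi : 'I_m + 'I_p -> 'I_q) (wd : signal q)
    (a : 'I_L -> 'I_q -> R) (c : R) :
  model_class B -> B !=set0 -> io_partition pi B -> has_state_space B n ->
  B wd -> persistently_exciting (n + L) (window 1 T (ucomp pi \o wd)) ->
  (forall j : nat, (j <= T - L)%N -> difference_form a c wd (1 + j%:Z) = 0) ->
  exists2 al : 'I_n.+1 -> R, exists i, al i != 0 &
    forall w, B w -> forall t : int,
      \sum_i al i * difference_form a c w (t + i%:Z) = 0.
Proof.
move=> modB neB ioB [m' [p' [pi' [bij' [A [B' [C [D [E [F ssB]]]]]]]]]].
move=> Bwd pe zero.
have le_m := inputs_leq modB neB ioB bij' ssB.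
have [_ _ tiB] := modB.
set K := (n + L)%N in pe.
have [f []] := state_space_window_spanned A B' C D E F K bij'.
set S := mkset _ => f1 spanw.
have span1 b : spanned S f (fun=> b).
  apply: spanned_ext (spannedZ b (spanned_base S f None)) => w _ /=.
  by rewrite f1 mulr1.
pose g (j : option ('I_K * 'I_m + 'I_n.+1))
      (s : signal q * @signal R n) : R :=
  match j with
  | Some (inl kc) => s.1 (1 + kc.1%:Z) (pi (inl kc.2)) 0
  | Some (inr i) => difference_form a c s.1 (1 + i%:Z)
  | None => 1
  end.
have spang j : spanned S f (g j).
  case: j => [[[k l]|i]|]; [exact: spanw| |exact: span1].
  apply: spannedD => //; apply: spanned_sum => k _; apply: spanned_sum => l _.
  apply: spannedZ; rewrite -addrA -PoszD; apply: spanw.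
  by have := ltn_ord i; have := ltn_ord k; rewrite /K; lia.
(* Here [m' <= m] enters: [n + K m' + 1 < K m + (n + 1) + 1]. *)
have [|b [j bj] rel] := spanned_dependent spang.
  rewrite !card_option !card_sum !card_prod !card_ord ltnS.
  by rewrite addnS ltnS addnC leq_add2r leq_mul2l le_m orbT.
pose bu k l := b (Some (inl (k, l))).
pose al i := b (Some (inr i)).
(* Time invariance carries the relation from windows at time 1 to every start [t]. *)
have {}rel w t : B w -> \sum_k \sum_l bu k l * w (t + k%:Z) (pi (inl l)) 0 +
    \sum_i al i * difference_form a c w (t + i%:Z) + b None = 0.
  move=> /(time_invariant_shift (t - 1) tiB); rewrite {1}ssB => -[x xP].
  rewrite -[RHS](rel (fun s => w (s + (t - 1)), x)) //.
  rewrite big_option mulr1 big_sumType; congr (_ + _ + _).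
    rewrite pair_bigA; apply: eq_bigr => -[k l] _ /=.
    by congr (_ * w _ _ _); ring.
  apply: eq_bigr => i _; congr (_ * (_ + _)).
  apply: eq_bigr => k _; apply: eq_bigr => l _ /=.
  by congr (_ * w _ _ _); ring.
have [bu0 b0] : (forall k l, bu k l = 0) /\ b None = 0.
  apply: (exciting_form_eq0 pe) => i le_i.
  rewrite -[RHS](rel wd (1 + i%:Z) Bwd) [X in _ = _ + X + _]big1 ?addr0.
    congr (_ + _); apply: eq_bigr => k _; apply: eq_bigr => l _.
    by rewrite mxE.
  (* As [i <= T - (n + L)] and [h <= n], the shifted form stays within the data, where it
     vanishes. *)
  have [_ KT _] := pe.
  move=> h _; rewrite -addrA -PoszD zero ?mulr0 //.
  by have := ltn_ord h; move: le_i KT; rewrite /K; lia.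
exists al.
  case: j bj => [[[k l]|i]|]; last by rewrite b0 eqxx.
    by rewrite -/(bu k l) bu0 eqxx.
  by exists i.
move=> w Bw t; rewrite -[RHS](rel w t Bw) b0 addr0.
rewrite [X in _ = X + _]big1 ?add0r //.
by move=> k _; rewrite big1 // => l _; rewrite bu0 mul0r.
Qed.

(* Patching shows that the past and the future of the form do not interact; a
   sequence satisfying a scalar recursion is determined by either. *)
Lemma difference_form_constant (R : realType) (q n L : nat)
    (B : set (@signal R q)) (a : 'I_L -> 'I_q -> R) (c : R) (al : 'I_n -> R) :
  controllable B -> (exists i, al i != 0) ->
  (forall w, B w -> forall t : int,
     \sum_i al i * difference_form a c w (t + i%:Z) = 0) ->
  forall w1 w2, B w1 -> B w2 ->
    difference_form a c w1 = difference_form a c w2.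
Proof.
move=> contB aln rec w1 w2 B1 B2.
have recB v w (t : int) : B v -> B w -> \sum_i al i *
    (difference_form a c v (t + i%:Z) - difference_form a c w (t + i%:Z)) = 0.
  move=> Bv Bw; under eq_bigr do rewrite mulrBr.
  by rewrite sumrB !rec // subrr.
have [t2 [w [_ Bw ww1 ww2]]] := contB _ _ B1 B2 0.
have eqw1 : difference_form a c w = difference_form a c w1.
  apply/funext => t; apply/eqP; rewrite -subr_eq0; apply/eqP.
  (* For starting times up to [- L] the whole window lies before the patching time 0. *)
  apply: (recursion_forward (e := fun t => _ - _) (t0 := - L%:Z) aln) t.
    by move=> t; apply: recB.
  move=> t tL; apply/eqP; rewrite subr_eq0; apply/eqP; congr (_ + _).
  apply: eq_bigr => k _; apply: eq_bigr => l _; rewrite ww1 //.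
  by have := ltn_ord k; lia.
rewrite -eqw1; apply/funext => t; apply/eqP; rewrite -subr_eq0; apply/eqP.
apply: (recursion_backward (e := fun t => _ - _) (t0 := t2) aln) t.
  by move=> t; apply: recB.
move=> t tL; apply/eqP; rewrite subr_eq0; apply/eqP; congr (_ + _).
by apply: eq_bigr => k _; apply: eq_bigr => l _; rewrite ww2 //; lia.
Qed.

(** * Affine combinations of the data windows *)

Theorem theorem7 (R : realType) (q m p : nat) (B : set (@signal R q))
    (pi : 'I_m + 'I_p -> 'I_q) (n T L : nat) (wd : 'I_T -> 'cV[R]_q)
    (B_class : model_class B)
    (B_contr : controllable B)
    (B_nonempty : B !=set0)
    (pi_io : io_partition pi B)
    (n_order : is_order B n)
    (wd_traj : restriction B 1 T wd)
    (L_gt0 : (0 < L)%N)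
    (ud_pe : persistently_exciting (n + L) (fun t => ucomp pi (wd t))) :
  forall w : 'I_L -> 'cV[R]_q, restriction B 1 L w ->
    exists g : 'cV[R]_(T - L).+1,
      colseq w = hankel L wd *m g /\
      (const_mx 1 : 'rV[R]_(T - L).+1) *m g = 1%:M.
Proof.
move=> _ [w Bw <-]; case: wd_traj ud_pe => v Bv <- pe.
have [_ KT _] := pe; have le_LT : (L <= T)%N by lia.
have [ssB _] := n_order.
(* The row of ones in [H] and the entry 1 in [r] encode the condition on the sum of [g]. *)
pose H := col_mx (hankel L (window 1 T v)) (const_mx 1 : 'rV[R]_(T - L).+1).
pose r := row_mx (colseq (window 1 L w))^T (1%:M : 'M[R]_1).
have [/submxP[g rg]|/not_submx_separate[z Hz rz]] := boolP (r <= H^T)%MS.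
  have : r^T = H *m g^T by rewrite rg trmx_mul trmxK.
  rewrite tr_row_mx trmxK trmx1 mul_col_mx => /eq_col_mx[e1 e2].
  by exists g^T.
(* The separating [z] is read as a difference form; [Hz] says that it vanishes on the data. *)
pose a k l := usubmx z (mxvec_index k l) 0.
pose c := dsubmx z 0 0.
have zero (j : nat) : (j <= T - L)%N -> difference_form a c v (1 + j%:Z) = 0.
  rewrite -ltnS => lt_j; have /matrixP/(_ (Ordinal lt_j) 0) := Hz.
  rewrite -[z]vsubmxK tr_col_mx mul_row_col !mxE big_ord1 !mxE mul1r => eq0.
  rewrite -[RHS]eq0 sum_mxvec_index; congr (_ + _); last by rewrite /c mxE.
  apply: eq_bigr => k _; apply: eq_bigr => l _.
  by rewrite mxE hankel_window //= mulrC.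
have [al aln rec] :=
  difference_form_recursion B_class B_nonempty pi_io ssB Bv pe zero.
(* The form takes on [w] the value 0 it has on the data, so [z] cannot separate [r]. *)
have := difference_form_constant B_contr aln rec Bw Bv.
move=> /(congr1 (fun f => f (1 + 0%:Z))); rewrite (zero 0%N) // => w0.
case/eqP: rz; apply/matrixP => i j; rewrite !ord1 -[z]vsubmxK mul_row_col.
rewrite !mxE big_ord1 !mxE mul1r -[RHS]w0 sum_mxvec_index /difference_form.
congr (_ + _); last by rewrite /c mxE.
apply: eq_bigr => k _; apply: eq_bigr => l _.
by rewrite /a !mxE mxvecE !mxE /window addr0 mulrC.
Qed.
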